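(* Let $b$ be a bounded analytic function on $\mathbb{D}$ with $\|b\|_{H^\infty(\mathbb{D})}=1$, and let $\zeta\in\mathbb{T}$ be such that $\zeta\in\sigma(b)$. Then the de Branges-Rovnyak space $H(b)$ does not embed into the local Dirichlet space $\mathcal{D}_\zeta$.
   Context: $\mathbb{D}$ is the open unit disk in $\mathbb{C}$, $\mathbb{T}=\partial\mathbb{D}$, $dA$ is two-dimensional Lebesgue measure, and $H^2(\mathbb{D})$, $H^\infty(\mathbb{D})$ are the usual Hardy spaces. For an analytic function $b$ on $\mathbb{D}$ with $\|b\|_{H^\infty(\mathbb{D})}\le 1$, the de Branges-Rovnyak space $H(b)$ is the reproducing kernel Hilbert space of functions on $\mathbb{D}$ with reproducing kernel $k^b(z,\omega)=\frac{1-\overline{b(\omega)}b(z)}{1-\overline{\omega}z}$, $z,\omega\in\mathbb{D}$; its norm is denoted $\|\cdot\|_b$. One has $H(b)\subseteq H^2(\mathbb{D})$ with $\|f\|_{H^2}\le\|f\|_b$. For $b$ with $\|b\|_{H^\infty(\mathbb{D})}=1$, the boundary spectrum is $\sigma(b)=\{\lambda\in\mathbb{T}: \liminf_{z\to\lambda}|b(z)|<1\}$, where $z$ ranges over $\mathbb{D}$. This set is not necessarily closed. For $\zeta\in\mathbb{T}$ and $f$ holomorphic on $\mathbb{D}$, the local Dirichlet integral is $D_\zeta(f)=\frac1\pi\int_{\mathbb{D}}|f'(z)|^2\frac{1-|z|^2}{|z-\zeta|^2}\,dA(z)$. The local Dirichlet space is $\mathcal{D}_\zeta=\{f \text{ holomorphic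 on }\mathbb{D}: D_\zeta(f)<\infty\}\subseteq H^2(\mathbb{D})$, with norm given by $\|f\|_{\mathcal{D}_\zeta}^2=\|f\|_{H^2}^2+D_\zeta(f)$. ''$H(b)$ embeds into $\mathcal{D}_\zeta$'' means: $H(b)\subseteq\mathcal{D}_\zeta$ and the inclusion is bounded, i.e. there is $C>0$ with $\|f\|_{H^2}^2+D_\zeta(f)\le C\|f\|_b^2$ for all $f\in H(b)$. *)

(* Defs.v *)
From mathcomp Require Import all_boot all_order all_algebra.
From mathcomp Require Import all_classical all_reals all_analysis.
From mathcomp Require Import complex.
Import Order.TTheory GRing.Theory Num.Theory.
Import numFieldNormedType.Exports.
Import ComplexField.Normc.

Set Implicit Arguments.
Unset Strict Implicit.
Unset Printing Implicit Defensive.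

Local Open Scope classical_set_scope.
Local Open Scope ring_scope.
Local Open Scope complex_scope.

(* Analysis attaches its topology and its normed module structure to the
   regular algebra [(R[i])^o] (convertible to [R[i]]), not to [R[i]]. *)
Notation CC R := ((R[i])^o) (only parsing).

Section Disk.
Variable R : realType.
Local Notation C := (CC R).
Implicit Types (f b : C -> C) (z w zeta : C).

Definition disk : set C := [set z | `|z| < 1].

Definition circle : set C := [set z | `|z| = 1].

(* [derivable] over the scalar field [R[i]] is complex differentiability. *)
Definition holomorphic_on_disk f : Prop :=
  forall z, disk z -> derivable f z 1.

(* ||f||_{H^infty} and ||f||_{H^2}^2, as elements of [0, +oo]. *)
Definition Hinfty_norm f : \bar R :=
  ereal_sup [set (normc (f z))%:E | z in disk].

Definition circle_pt (r t : R) : C := (r * cos t) +i* (r * sin t).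

Definition H2_normsq f : \bar R :=
  ereal_sup [set ((2 * pi)^-1%R%:E *
                  \int[lebesgue_measure]_(t in `[0%R, (2 * pi)%R])
                     (normc (f (circle_pt r t)) ^+ 2)%:E)%E
            | r in [set r : R | 0 <= r < 1]].

Definition local_dirichlet_integral zeta f : \bar R :=
  (pi^-1%:E *
   \int[lebesgue_measure \x lebesgue_measure]_
      (p in [set p : R * R | disk (p.1 +i* p.2)])
      (normc ('D_1 f (p.1 +i* p.2 : C)) ^+ 2 *
       ((1 - normc (p.1 +i* p.2) ^+ 2) /
        normc (p.1 +i* p.2 - zeta) ^+ 2))%:E)%E.

Definition local_dirichlet zeta : set (C -> C) :=
  [set f | holomorphic_on_disk f /\
           (local_dirichlet_integral zeta f < +oo)%E].

Definition local_dirichlet_normsq zeta f : \bar R :=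
  (H2_normsq f + local_dirichlet_integral zeta f)%E.

Definition boundary_spectrum b : set C :=
  [set l | circle l /\
     (limf_einf (fun z => (normc (b z))%:E) (within disk (nbhs l)) < 1)%E].

Definition dBR_kernel b z w : C := (1 - (b w)^* * b z) / (1 - w^* * z).

End Disk.

(* A function on [X] is represented by its extension by 0 to the whole type, so
   that Leibniz (pointwise) equality is equality on [X].  [ip] is only relevant
   on [H]; it is linear in its first argument. *)
Record is_rkhs (R : realType) (T : Type) (X : set T) (k : T -> T -> CC R)
    (H : set (T -> CC R)) (ip : (T -> CC R) -> (T -> CC R) -> CC R) : Prop := {
  rkhs_supp : forall f, H f -> forall x, ~ X x -> f x = 0;
  rkhs_zero : H 0;
  rkhs_linear : forall (a : R[i]) f g, H f -> H g -> H (a *: f + g);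
  rkhs_ip_linear : forall (a : R[i]) f g h, H f -> H g -> H h ->
    ip (a *: f + g) h = a * ip f h + ip g h;
  rkhs_ip_conj : forall f g, H f -> H g -> ip g f = (ip f g)^*;
  rkhs_ip_ge0 : forall f, H f -> 0 <= ip f f;
  rkhs_ip_eq0 : forall f, H f -> ip f f = 0 -> f = 0;
  rkhs_complete : forall u : nat -> (T -> CC R), (forall n, H (u n)) ->
    (forall e : R, 0 < e -> exists N : nat, forall m n : nat,
       (N <= m)%N -> (N <= n)%N ->
       complex.Re (ip (u m - u n) (u m - u n)) < e) ->
    exists2 f, H f &
      forall e : R, 0 < e -> exists N : nat, forall n : nat,
        (N <= n)%N -> complex.Re (ip (u n - f) (u n - f)) < e;
  rkhs_kernel : forall w, X w -> H (patch (fun=> 0) X (k^~ w));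
  rkhs_reproducing : forall f w, H f -> X w ->
    f w = ip f (patch (fun=> 0) X (k^~ w)) }.

(* [H] with inner product [ip] is the space H(b). *)
Definition is_dBR (R : realType) (b : CC R -> CC R) (H : set (CC R -> CC R))
    (ip : (CC R -> CC R) -> (CC R -> CC R) -> CC R) : Prop :=
  is_rkhs (@disk R) (dBR_kernel b) H ip.

Definition embeds_local_dirichlet (R : realType) (zeta : CC R)
    (H : set (CC R -> CC R))
    (ip : (CC R -> CC R) -> (CC R -> CC R) -> CC R) : Prop :=
  H `<=` local_dirichlet zeta /\
  exists2 M : R, 0 < M & forall f, H f ->
    (local_dirichlet_normsq zeta f <= (M * complex.Re (ip f f))%:E)%E.

(* Main.v *)
Require Import Defs.
From mathcomp Require Import all_boot all_order all_algebra.
From mathcomp Require Import all_classical all_reals all_analysis.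
From mathcomp Require Import complex ring lra.
Import Order.TTheory GRing.Theory Num.Theory.
Import numFieldNormedType.Exports.
Import ComplexField.Normc.

Set Implicit Arguments.
Unset Strict Implicit.
Unset Printing Implicit Defensive.

Local Open Scope classical_set_scope.
Local Open Scope ring_scope.
Local Open Scope complex_scope.

(** If [H(b)] embeds into the local Dirichlet space at [zeta], then in
    particular the embedding inequality holds for the reproducing kernels
    [k_w], where it implies [D_zeta(k_w) <= M (1 - |b w|^2) / (1 - |w|^2)].
    Since [zeta] is in the boundary spectrum, there are a constant [c < 1] and
    points [w] of the disk arbitrarily close to [zeta] with [|b w| < c].
    Writing [s = 1 - |w|], the right-hand side is at most [M / s].

    On the other hand [D_zeta(k_w)] is at least a positive constant, depending
    on [c] only, times [1 / (s |w - zeta|^2)] (dBR_kernel_dirichlet_ge), and the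
    two bounds are incompatible once [w] is close enough to [zeta].

    The lower bound is local.  On the disk,
      [k_w'(z) (1 - w^* z) = w^* k_w(z) - (b w)^* b'(z)].
    The Schwarz-Pick inequality bounds [|b'(z)|] by
    [(1 - |b z|^2) / (1 - |z|^2)], and for [z] hyperbolically close to [w] the
    modulus of [k_w(z)] is at least nearly that same quotient; as [|b w| <= c],
    the second term cannot cancel the first.  Hence [|k_w'|] is of order at
    least [1 / s^2] on a whole square of side comparable to [s] next to [w]
    (dBR_kernel_derive_ge).  On that square the weight
    [(1 - |z|^2) / |z - zeta|^2] is of order at least [s / |w - zeta|^2], and it
    suffices to bound the integral from below by its part over the square.  The
    argument is pointwise, so no mean value property of [k_w'] comes in.

    The Schwarz-Pick inequality itself is read off the kernel: it is the
    Cauchy-Schwarz inequality [|<k_w, k_z>|^2 <= ||k_w||^2 ||k_z||^2]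
    (dBR_schwarz_pick), so no maximum principle comes in either. *)

(** * The modulus of a complex number *)

Section ComplexModulus.
Variable R : realType.
Local Notation C := (CC R).
Implicit Types (z w : C).

Lemma normr_normc z : `|z| = (normc z)%:C.
Proof. by case: z. Qed.

Lemma normc_ge0 z : 0 <= normc z.
Proof. by case: z => x y; exact: sqrtr_ge0. Qed.

Lemma diskE z : disk z = (normc z < 1) :> Prop.
Proof. by rewrite /disk /= normr_normc -[1 in X in X = _]/(1%:C) ltcR. Qed.

Lemma ler_normcD z w : normc (z + w) <= normc z + normc w.
Proof. exact: (@le_normcD R z w). Qed.

Lemma normc_opp z : normc (- z) = normc z.
Proof. exact: (@normcN R z). Qed.

Lemma normc_distC z w : normc (z - w) = normc (w - z).
Proof. by rewrite -normc_opp opprB. Qed.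

Lemma ler_normcB z w : normc z - normc w <= normc (z - w).
Proof. by rewrite lerBlDr -{1}(subrK w z) ler_normcD. Qed.

Lemma normc_conj z : normc z^* = normc z.
Proof. by case: z => x y /=; rewrite sqrrN. Qed.

Lemma normc_sqr z : normc z ^+ 2 = complex.Re z ^+ 2 + complex.Im z ^+ 2.
Proof. by case: z => x y /=; rewrite sqr_sqrtr// addr_ge0// sqr_ge0. Qed.

Lemma mul_conjc z : z^* * z = (normc z ^+ 2)%:C.
Proof.
rewrite normc_sqr; case: z => x y /=; apply/eqP; rewrite eq_complex /=.
by apply/andP; split; apply/eqP; ring.
Qed.

Lemma normc_real_complex (x : R) : 0 <= x -> normc x%:C = x.
Proof. by move=> x0; rewrite /= expr0n addr0 sqrtr_sqr ger0_norm. Qed.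

Lemma normc_oneBmul_conj z :
  normc z <= 1 -> normc (1 - z^* * z) = 1 - normc z ^+ 2.
Proof.
move=> z1; rewrite mul_conjc -(rmorph1 (real_complex R)) -rmorphB.
by rewrite normc_real_complex// subr_ge0 expr_le1// normc_ge0.
Qed.

(** [1 - w^* z] and [1 - z^* z] differ by [(z - w)^* z]. *)
Lemma normc_oneBmul_conj_le w z : normc z < 1 ->
  normc (1 - w^* * z) <= (1 - normc z ^+ 2) + normc (z - w).
Proof.
move=> z1; rewrite -(normc_oneBmul_conj (ltW z1)).
rewrite (_ : 1 - w^* * z = (1 - z^* * z) + (z - w)^* * z); last first.
  by rewrite rmorphB; ring.
apply: le_trans (ler_normcD _ _) _.
by rewrite lerD2l normcM normc_conj ler_piMr ?normc_ge0//; exact: ltW.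
Qed.

Lemma oneBmul_conj_ge z w : normc z < 1 -> normc w < 1 ->
  1 - normc z <= normc (1 - z^* * w).
Proof.
move=> z1 w1; apply: le_trans (ler_normcB _ _).
rewrite normc1 normcM normc_conj lerD2l lerN2 ler_piMr ?normc_ge0//.
exact: ltW.
Qed.

(** This identity turns the Cauchy-Schwarz inequality for the kernel into the
    contraction property of [b] for the pseudo-hyperbolic distance. *)
Lemma pick_identity z w :
  normc (1 - z^* * w) ^+ 2 - normc (z - w) ^+ 2 =
  (1 - normc z ^+ 2) * (1 - normc w ^+ 2).
Proof. by rewrite !normc_sqr; case: z => x y; case: w => u v /=; ring. Qed.

Lemma continuous_normc : continuous (@normc R : C -> R).
Proof.
move=> z; have FF : Filter (nbhs z) := @nbhs_filter C z.
apply/cvgrPdist_lt => e e0.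
have e0' : 0 < e%:C :> R[i] by rewrite -[0]/(0%:C) ltcR.
apply/(@nbhs_normP R[i] C z); exists e%:C => //= w.
rewrite /= normr_normc ltcR; apply: le_lt_trans.
rewrite ler_norml ler_normcB andbT lerNl opprB normc_distC.
exact: ler_normcB.
Qed.

Lemma open_disk : open (@disk R).
Proof.
rewrite (_ : @disk R = @normc R @^-1` [set x : R | x < 1]); last first.
  by apply/funext => z; rewrite diskE.
by apply: open_comp; [move=> ? _; exact: continuous_normc | exact: open_lt].
Qed.

Lemma nbhs_disk z : disk z -> nbhs z (@disk R).
Proof. by move=> Dz; apply: open_nbhs_nbhs; split => //; exact: open_disk. Qed.

Lemma normc_circle z : circle z -> normc z = 1.
Proof. by rewrite /circle /= normr_normc => -[]. Qed.

End ComplexModulus.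

(** * The Schwarz-Pick inequality *)

(** The classical argument: expand [<h, h> >= 0] for
    [h = <g, g> f - <f, g> g]. *)
Lemma rkhs_cauchy_schwarz (R : realType) (T : Type) (X : set T)
    (k : T -> T -> CC R) (H : set (T -> CC R)) ip (Hk : is_rkhs X k H ip) f g :
  H f -> H g ->
  normc (ip f g) ^+ 2 <= complex.Re (ip f f) * complex.Re (ip g g).
Proof.
move=> Hf Hg.
have HZ (a : R[i]) u : H u -> H (a *: u).
  move=> Hu; rewrite -[_ *: _]addr0.
  by apply: (rkhs_linear Hk) => //; exact: (rkhs_zero Hk).
have ip0 h : H h -> ip 0 h = 0.
  move=> Hh; have := rkhs_ip_linear Hk 1 (rkhs_zero Hk) (rkhs_zero Hk) Hh.
  rewrite scaler0 addr0 mul1r => /esym/eqP.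
  by rewrite -subr_eq0 addrK => /eqP.
have ipZ (a : R[i]) u h : H u -> H h -> ip (a *: u) h = a * ip u h.
  move=> Hu Hh; rewrite -[_ *: _]addr0 (rkhs_ip_linear Hk)//.
    by rewrite ip0// addr0.
  exact: (rkhs_zero Hk).
pose h := ip g g *: f + (- ip f g) *: g.
have Hh : H h by apply: (rkhs_linear Hk) => //; exact: HZ.
have ipl u : H u -> ip h u = ip g g * ip f u - ip f g * ip g u.
  move=> Hu; rewrite (rkhs_ip_linear Hk) ?ipZ ?mulNr//.
  exact: HZ.
have ipr u : H u -> ip u h = (ip g g * ip f u - ip f g * ip g u)^*.
  by move=> Hu; rewrite -ipl//; exact: (rkhs_ip_conj Hk).
have := rkhs_ip_ge0 Hk Hh.
have := rkhs_ip_ge0 Hk Hg.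
have := rkhs_ip_ge0 Hk Hf.
rewrite (ipl _ Hh) (ipr _ Hf) (ipr _ Hg) (rkhs_ip_conj Hk Hf Hg) normc_sqr.
have : ip g g = 0 -> ip f g = 0.
  move=> /(rkhs_ip_eq0 Hk Hg) g0.
  by rewrite (rkhs_ip_conj Hk Hg Hf) g0 ip0// conjc0.
case: (ip g g) => G G'; case: (ip f f) => F F'; case: (ip f g) => p q.
rewrite !lecE /= => G0 /andP[/eqP-> F0] /andP[/eqP G'0 Gge0].
rewrite G'0 in G0 *.
have [G00|Gn0] := eqVneq G 0.
  by move: G0; rewrite G00 => /(_ erefl)[-> ->] _; rewrite expr0n/= addr0 mulr0.
move=> /andP[_ h0].
have Gp : 0 < G by rewrite lt_def Gn0.
rewrite -subr_ge0 -(pmulr_rge0 _ Gp); apply: le_trans h0 _.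
by nra.
Qed.

Section SchwarzPick.
Variable R : realType.
Local Notation C := (CC R).
Implicit Types (b : C -> C) (z w : C).

(** Dividing by both factors, [b] contracts the pseudo-hyperbolic distance
    [|z - w| / |1 - w^* z|]; the division-free form also makes sense where
    [|b| = 1]. *)
Definition schwarz_pick b := forall z w, disk z -> disk w ->
  normc (b z - b w) * normc (1 - w^* * z) <=
  normc (1 - (b w)^* * b z) * normc (z - w).

Lemma dBR_kernel_diag b z :
  dBR_kernel b z z = ((1 - normc (b z) ^+ 2) / (1 - normc z ^+ 2))%:C.
Proof.
rewrite /dBR_kernel !mul_conjc -(rmorph1 (real_complex R)) -!rmorphB.
by rewrite -fmorph_div.
Qed.

(** Cauchy-Schwarz for [k_w] and [k_z] gives
    [|k_w(z)|^2 <= k_w(w) k_z(z)], which is the claim by [pick_identity]. *)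
Lemma dBR_schwarz_pick b H ip : is_dBR b H ip -> schwarz_pick b.
Proof.
move=> Hb z w Dz Dw.
have := rkhs_cauchy_schwarz Hb (rkhs_kernel Hb Dw) (rkhs_kernel Hb Dz).
rewrite -!(rkhs_reproducing Hb)//; try exact: (rkhs_kernel Hb).
rewrite /patch !mem_set// !dBR_kernel_diag /dBR_kernel normcM normcV /=.
move: Dz Dw; rewrite !diskE => z1 w1.
have w2 : 0 < 1 - normc w ^+ 2 by rewrite subr_gt0 expr_lt1// normc_ge0.
have z2 : 0 < 1 - normc z ^+ 2 by rewrite subr_gt0 expr_lt1// normc_ge0.
have X0 : 0 < normc (1 - w^* * z).
  by apply: lt_le_trans (oneBmul_conj_ge w1 z1); rewrite subr_gt0.
rewrite exprMn exprVn mulf_div ler_pdivrMr ?exprn_gt0//.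
rewrite mulrAC ler_pdivlMr ?mulr_gt0//.
rewrite -!pick_identity => h.
rewrite -ler_sqr ?nnegrE ?mulr_ge0 ?normc_ge0//.
rewrite (normc_distC (b z)) (normc_distC z) !exprMn.
by lra.
Qed.

(** The infinitesimal form, obtained by letting the other point tend to [z] in
    the difference quotient. *)
Lemma schwarz_pick_derive b z : disk z -> derivable b z 1 -> schwarz_pick b ->
  normc (b z) <= 1 ->
  normc ('D_1 b z) * (1 - normc z ^+ 2) <= 1 - normc (b z) ^+ 2.
Proof.
move=> Dz dbz SP bz1.
have cb : {for z, continuous b}.
  by apply: differentiable_continuous; exact/derivable1_diffP.
have cv : (fun h : C => normc (h^-1 *: (b (h *: (1 : C) + z) - b z))) @ 0^'
    --> normc ('D_1 b z).
  apply: (@cvg_comp _ _ _ _ (@normc R : C -> R)); first exact: dbz.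
  exact: continuous_normc.
have hz : (fun h : C => h *: (1 : C) + z) @ 0^' --> z.
  rewrite -[X in _ --> X](add0r z) -[X in X + z](scale0r (1 : C)).
  apply: cvgD; last exact: cvg_cst.
  by apply: cvgZr_tmp; apply: (@nbhs_dnbhs C 0).
have cz : (fun h : C => normc (1 - z^* * (h *: (1 : C) + z))) @ 0^' -->
    1 - normc z ^+ 2.
  move: Dz; rewrite diskE => /ltW z1; rewrite -normc_oneBmul_conj//.
  apply: (@cvg_comp _ _ _ _ (@normc R : C -> R)); last exact: continuous_normc.
  by apply: cvgB; [exact: cvg_cst | apply: cvgMl_tmp; exact: hz].
have cbz : (fun h : C => normc (1 - (b z)^* * b (h *: (1 : C) + z))) @ 0^' -->
    1 - normc (b z) ^+ 2.
  rewrite -normc_oneBmul_conj//.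
  apply: (@cvg_comp _ _ _ _ (@normc R : C -> R)); last exact: continuous_normc.
  apply: cvgB; [exact: cvg_cst | apply: cvgMl_tmp].
  by apply: (@cvg_comp _ _ _ _ b); [exact: hz | exact: cb].
have PF : ProperFilter ((0 : C)^') by exact: Proper_dnbhs_numFieldType.
apply: (@ler_cvg_to C ((0 : C)^') PF R _ _ _ _ (cvgM cv cz) cbz).
have Dh : \forall h \near (0 : C)^', disk (h *: (1 : C) + z).
  exact: (hz _ (nbhs_disk Dz)).
have h0 : \forall h \near (0 : C)^', h != 0.
  by rewrite near_withinE; exact: nearW.
apply: filterS2 Dh h0 => h Dh h0 /=.
have := SP _ _ Dh Dz.
rewrite addrK [h *: _]mulr1 => SPh.
rewrite -[h^-1 *: _]/(h^-1 * _) normcM normcV.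
have nh0 : 0 < normc h.
  by rewrite lt_def normc_ge0 andbT; apply: contra h0 => /eqP/eq0_normc ->.
by rewrite -mulrA ler_pdivrMl// [leRHS]mulrC.
Qed.

End SchwarzPick.

(** * The derivative of the kernel near its pole *)

(** The real inequality behind [dBR_kernel_derive_ge], with [W = |w|],
    [Z = |z|], [a = |b w|], [D = |b z|], [d = |b z - b w|],
    [P = |1 - (b w)^* b z|], [X = |1 - w^* z|], [r = |z - w|], [B = |b'(z)|]
    and [F = |k_w'(z)|].  Since [r <= e X], both [P] and [X] are, up to factors
    [1 + O(e)], bounded on the useful side by [1 - D^2] and [1 - Z^2], so that
    the main term [W P / X] is at least
    [(1 - 3 e) (1 - D^2) / (1 - Z^2)] while the other one is at most [c] times
    the same quotient; the choice of [e] makes [1 - c = 8 e]. *)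
Lemma kernel_derive_ge_arith (R : realFieldType)
    (c W Z a D d P X r B F : R) (e := (1 - c) / 8) :
  c < 1 -> 1 - e <= W -> W < 1 -> a <= c ->
  0 <= a -> 0 <= D -> 0 <= P -> 0 <= B -> B * (1 - Z ^+ 2) <= 1 - D ^+ 2 ->
  1 - W <= X -> r <= e * (1 - W) -> X <= (1 - Z ^+ 2) + r ->
  d * X <= P * r -> 1 - D ^+ 2 <= P + d -> P <= 2 -> D <= a + d ->
  W * (P / X) <= a * B + F * X ->
  (1 - c) ^+ 2 / 4 <= F * X * (1 - Z ^+ 2).
Proof.
move=> c1 We W1 ac a0 D0 P0 B0 BD WX rW XY dX DP P2 Dad KF.
have X0 : 0 < X by apply: lt_le_trans WX; rewrite subr_gt0.
have e0 : 0 < e by rewrite /e; lra.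
have e8 : e <= 1 / 8 by rewrite /e; lra.
have ce : c = 1 - 8 * e by rewrite /e; lra.
have rX : r <= e * X by apply: le_trans rW _; rewrite ler_pM2l.
have dP : d <= e * P.
  rewrite -(ler_pM2r X0); apply: le_trans dX _; rewrite mulrAC mulrC.
  by rewrite ler_wpM2r.
set Y := 1 - Z ^+ 2 in XY BD *; set S := 1 - D ^+ 2 in DP BD.
have XeY : (1 - e) * X <= Y by lra.
have Y0 : 0 <= Y by apply: le_trans XeY; apply: mulr_ge0; lra.
(* [S <= (1 + e) P] and [(1 - e) (1 + e) <= 1]. *)
have PS : (1 - e) * S <= P.
  have h : (1 - e) * S <= (1 - e) * ((1 + e) * P) by apply: ler_wpM2l; lra.
  by apply: le_trans h _; nra.
have D1 : D <= 1 - 6 * e by nra.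
have S6 : 6 * e <= S by rewrite /S; nra.
have h1 : W * (P / X) * Y <= (a * B + F * X) * Y by rewrite ler_wpM2r.
have h2 : W * P * (1 - e) <= W * (P / X) * Y.
  rewrite (_ : W * (P / X) * Y = W * P * (Y / X)); last by ring.
  apply: ler_wpM2l; first by apply: mulr_ge0 => //; lra.
  by rewrite ler_pdivlMr.
have h3 : a * (B * Y) <= c * S.
  by apply: ler_pM => //; apply: mulr_ge0.
have h4 : (1 - e) * (1 - e) * ((1 - e) * S) <= W * P * (1 - e).
  have : (1 - e) * ((1 - e) * S) <= W * P by apply: ler_pM => //; nra.
  by nra.
have h5 : (1 - e) * (1 - e) * ((1 - e) * S) - c * S <= F * X * Y by lra.
have h6 : 6 * e * (5 * e) <= S * (5 * e + 3 * e ^+ 2 - e ^+ 3).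
  by apply: ler_pM => //; nra.
have -> : (1 - c) ^+ 2 / 4 = 16 * e ^+ 2 by rewrite /e; field.
apply: le_trans h5; rewrite [X in _ - X * S]ce.
apply: le_trans (_ : 30 * e ^+ 2 <= _); first by nra.
by move: h6; lra.
Qed.

Section KernelDerivative.
Variable R : realType.
Local Notation C := (CC R).
Implicit Types (b f : C -> C) (z w : C).

(** Differentiate [f(u) (1 - w^* u) = 1 - (b w)^* b(u)]. *)
Lemma dBR_kernel_derive b f z w :
  (forall u, disk u -> f u = dBR_kernel b u w) ->
  disk z -> disk w -> derivable b z 1 -> derivable f z 1 ->
  'D_1 f z * (1 - w^* * z) = w^* * dBR_kernel b z w - (b w)^* * 'D_1 b z.
Proof.
move=> fk Dz Dw db df.
have w1 : normc w < 1 by rewrite -diskE.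
pose g : C -> C := cst 1 - w^* \*: id.
have dg : is_derive z (1 : C) g (0 - w^* *: 1) by exact: is_deriveB.
have ek : \forall u \near z, (f * g) u = (cst 1 - (b w)^* \*: b) u.
  apply: filterS (nbhs_disk Dz) => u Du.
  rewrite /g !fctE fk// /dBR_kernel divfK//.
  have : 0 < normc (1 - w^* * u).
    apply: lt_le_trans (oneBmul_conj_ge w1 _); first by rewrite subr_gt0.
    by rewrite -diskE.
  by apply: contraTneq => ->; rewrite normc0 ltxx.
have dfg : is_derive z (1 : C) (f * g)
    (f z *: (0 - w^* *: (1 : C)) + g z *: 'D_1 f z).
  apply: (@is_deriveM R[i] C f g z 1 ('D_1 f z) _ _ dg).
  exact: (DeriveDef df).
have dcb : is_derive z (1 : C) (cst 1 - (b w)^* \*: b)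
    (0 - (b w)^* *: 'D_1 b z).
  have dbz : is_derive z (1 : C) b ('D_1 b z) := DeriveDef db erefl.
  exact: is_deriveB.
have := @near_eq_derive R[i] C C _ _ z 1 ek.
rewrite (@derive_val _ _ _ _ _ _ _ dfg) (@derive_val _ _ _ _ _ _ _ dcb).
rewrite fk// /g !fctE /= -![_ *: _]/(_ * _) mulr1 !sub0r => e.
have alg (K : comNzRingType) (p q r s t x : K) :
    r * - s + (1 - s * x) * p - - (t * q) = p * (1 - s * x) - (s * r - t * q).
  by ring.
move/eqP: e; rewrite -subr_eq0 => /eqP e.
apply/eqP; rewrite -subr_eq0; apply/eqP.
exact: (etrans (esym (alg R[i] _ _ _ _ _ _)) e).
Qed.

(** The two terms of [dBR_kernel_derive] cannot cancel near [w], because the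
    coefficient [b w] of the second one is bounded away from the circle. *)
Lemma dBR_kernel_derive_ge b f z w (c : R) (e := (1 - c) / 8) :
  holomorphic_on_disk b -> (forall u, disk u -> normc (b u) <= 1) ->
  schwarz_pick b ->
  (forall u, disk u -> f u = dBR_kernel b u w) -> derivable f z 1 ->
  disk z -> disk w -> c < 1 -> normc (b w) <= c ->
  1 - e <= normc w -> normc (z - w) <= e * (1 - normc w) ->
  (1 - c) ^+ 2 / 4 <=
    normc ('D_1 f z) * normc (1 - w^* * z) * (1 - normc z ^+ 2).
Proof.
move=> holb b1 SP fk df Dz Dw c1 bwc we zwe.
have w1 : normc w < 1 by rewrite -diskE.
have z1 : normc z < 1 by rewrite -diskE.
have e1 := dBR_kernel_derive fk Dz Dw (holb _ Dz) df.
have Xle := normc_oneBmul_conj_le w z1.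
have Ple : 1 - normc (b z) ^+ 2 <=
    normc (1 - (b w)^* * b z) + normc (b z - b w).
  rewrite -(normc_oneBmul_conj (b1 _ Dz)).
  rewrite (_ : 1 - (b z)^* * b z =
    (1 - (b w)^* * b z) + - ((b z - b w)^* * b z)); last first.
    by rewrite rmorphB; ring.
  apply: le_trans (ler_normcD _ _) _.
  rewrite lerD2l normc_opp normcM normc_conj ler_piMr ?normc_ge0//; exact: b1.
have P2 : normc (1 - (b w)^* * b z) <= 2.
  apply: le_trans (ler_normcD _ _) _.
  rewrite normc1 normc_opp normcM normc_conj (_ : 2 = 1 + 1)// lerD2l.
  by rewrite mulr_ile1 ?normc_ge0// b1.
have bzbw : normc (b z) <= normc (b w) + normc (b z - b w).
  by rewrite -[X in normc X <= _](subrK (b w)) addrC; exact: ler_normcD.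
have Kle : normc w * (normc (1 - (b w)^* * b z) / normc (1 - w^* * z)) <=
    normc (b w) * normc ('D_1 b z) + normc ('D_1 f z) * normc (1 - w^* * z).
  have -> : normc w * (normc (1 - (b w)^* * b z) / normc (1 - w^* * z)) =
      normc (w^* * dBR_kernel b z w).
    by rewrite /dBR_kernel !normcM normcV normc_conj.
  have -> : normc (b w) * normc ('D_1 b z) = normc ((b w)^* * 'D_1 b z).
    by rewrite normcM normc_conj.
  rewrite -normcM e1 addrC.
  rewrite -[X in normc X <= _](subrK ((b w)^* * 'D_1 b z)).
  exact: ler_normcD.
have SPd := schwarz_pick_derive Dz (holb _ Dz) SP (b1 _ Dz).
exact: (kernel_derive_ge_arith c1 we w1 bwc (normc_ge0 _) (normc_ge0 _)
  (normc_ge0 _) (normc_ge0 _) SPd (oneBmul_conj_ge w1 z1) zwe Xle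
  (SP _ _ Dz Dw) Ple P2 bzbw Kle).
Qed.

End KernelDerivative.

(** * Lower bounds for the local Dirichlet integral *)

Import HBNNSimple.

(** The integral of a nonnegative function is the supremum of the integrals of
    the simple functions below it, and [m] times the indicator of [A] is one of
    them; hence [f] may be non-measurable. *)
Lemma integral_ge_cst d (T : measurableType d) (R : realType)
    (mu : {measure set T -> \bar R}) (D A : set T) (f : T -> \bar R) (m : R) :
  measurable A -> A `<=` D -> 0 <= m -> (forall x, D x -> (0 <= f x)%E) ->
  (forall x, A x -> (m%:E <= f x)%E) ->
  (m%:E * mu A <= \int[mu]_(x in D) f x)%E.
Proof.
move=> mA AD m0 f0 mf; rewrite ge0_integralE//.
apply: ereal_sup_ubound; exists (scale_nnsfun (indic_nnsfun R mA) m0).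
  move=> x; change ((m * \1_A x)%:E <= (f \_ D) x)%E.
  rewrite patchE indicE; case: (boolP (x \in A)) => xA.
    by rewrite mem_set ?mulr1; [apply: mf|apply: AD]; rewrite -inE.
  by rewrite mulr0; case: ifPn => // /set_mem /f0.
have -> : mu A = sintegral mu (indic_nnsfun R mA).
  by rewrite -(sintegral_indic mu A).
by rewrite -sintegralrM.
Qed.

Lemma local_dirichlet_integral_ge (R : realType) (f : CC R -> CC R)
    (zeta : CC R) (x y r m : R) : 0 <= m -> 0 < r ->
  (forall u v, x <= u <= x + r -> y <= v <= y + r ->
    disk (u +i* v : CC R) /\
    m <= normc ('D_1 f (u +i* v : CC R)) ^+ 2 *
         ((1 - normc (u +i* v) ^+ 2) / normc (u +i* v - zeta) ^+ 2)) ->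
  ((pi^-1 * (m * r ^+ 2))%:E <= local_dirichlet_integral zeta f)%E.
Proof.
move=> m0 r0 H; rewrite /local_dirichlet_integral EFinM.
apply: lee_wpmul2l; first by rewrite lee_fin invr_ge0 pi_ge0.
pose A : set (R * R) := `[x, x + r] `*` `[y, y + r].
have mA : measurable A by apply: measurableX; exact: measurable_itv.
have muI (t : R) : lebesgue_measure `[t, t + r] = r%:E.
  by rewrite lebesgue_measure_itv/= lte_fin ltrDl r0 -EFinD addrAC subrr add0r.
have muA : (@lebesgue_measure R \x @lebesgue_measure R)%E A = (r ^+ 2)%:E.
  by rewrite product_measure1E//= !muI -EFinM.
rewrite EFinM -muA; apply: integral_ge_cst => //.
- by move=> [u v] [/=]; rewrite !in_itv/= => Hu Hv; exact: (H _ _ Hu Hv).1.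
- move=> [u v] /=; rewrite diskE => uv1; rewrite lee_fin.
  by rewrite mulr_ge0 ?divr_ge0 ?sqr_ge0// subr_ge0 expr_le1 ?normc_ge0// ltW.
- move=> [u v] [/=]; rewrite !in_itv/= lee_fin => Hu Hv.
  exact: (H _ _ Hu Hv).2.
Qed.

(** The real inequality behind [dBR_kernel_dirichlet_ge], with [k] the lower
    bound of [dBR_kernel_derive_ge], [X = |1 - w^* z|], [Z = |z|],
    [T = |z - zeta|], [r = |z - w|], [s = 1 - |w|] and [o = |w - zeta|]: near
    [w] one has [X <= 4 s], [1 - Z^2 <= 4 s] and [T <= 2 o]. *)
Lemma weighted_square_ge_arith (R : realFieldType) (k F X Z T r s o e : R) :
  0 <= k -> k <= F * X * (1 - Z ^+ 2) -> 0 < X -> X <= (1 - Z ^+ 2) + r ->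
  0 < T -> T <= r + o -> 1 - Z <= s + r -> r <= e * s -> Z < 1 -> 0 <= Z ->
  0 < s -> s <= o -> e <= 1 / 8 ->
  k ^+ 2 / (256 * s ^+ 3 * o ^+ 2) <= F ^+ 2 * ((1 - Z ^+ 2) / T ^+ 2).
Proof.
move=> k0 kF X0 XY T0 To Zs rs Z1 Z0 s0 so e8.
have o0 : 0 < o by exact: lt_le_trans so.
have r1 : r <= s / 8.
  by apply: le_trans rs _; rewrite mulrC; apply: ler_wpM2l; lra.
have Y0 : 0 < 1 - Z ^+ 2 by nra.
have Ys : 1 - Z ^+ 2 <= 9 / 4 * s.
  rewrite (_ : 1 - Z ^+ 2 = (1 + Z) * (1 - Z)); last by ring.
  rewrite (_ : 9 / 4 * s = 2 * (9 / 8 * s)); last by field.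
  by apply: ler_pM; lra.
set Y := 1 - Z ^+ 2 in kF XY Y0 Ys *.
have Ys4 : Y <= 4 * s by lra.
have Xs : X <= 4 * s by lra.
have To2 : T <= 2 * o by lra.
have num : k ^+ 2 <= (F * X * Y) ^+ 2.
  by rewrite ler_sqr ?nnegrE// (le_trans k0).
have den : (X ^+ 2 * Y) * T ^+ 2 <= 256 * s ^+ 3 * o ^+ 2.
  rewrite (_ : 256 * s ^+ 3 * o ^+ 2 =
    ((4 * s) ^+ 2 * (4 * s)) * (2 * o) ^+ 2); last by ring.
  have sq (p q : R) : 0 <= p -> p <= q -> p ^+ 2 <= q ^+ 2.
    by move=> p0 pq; rewrite ler_sqr ?nnegrE// (le_trans p0).
  by repeat apply: ler_pM; rewrite ?mulr_ge0 ?sqr_ge0 ?sq// ltW.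
have den0 : 0 < (X ^+ 2 * Y) * T ^+ 2 by rewrite !mulr_gt0 ?exprn_gt0.
have -> : F ^+ 2 * (Y / T ^+ 2) = (F * X * Y) ^+ 2 / ((X ^+ 2 * Y) * T ^+ 2).
  by field; rewrite !gt_eqF.
apply: ler_pM; rewrite ?sqr_ge0 ?invr_ge0//.
  by apply: le_trans den; exact: ltW.
by rewrite lef_pV2 ?posrE//; exact: lt_le_trans den.
Qed.

(** Integrate over the square of side [e (1 - |w|) / 2] with a corner at [w],
    whose points are within [e (1 - |w|)] of [w]. *)
Lemma dBR_kernel_dirichlet_ge (R : realType) (b f : CC R -> CC R)
    (zeta w : CC R) (c : R) (e := (1 - c) / 8) (k := (1 - c) ^+ 2 / 4) :
  holomorphic_on_disk b -> (forall u, disk u -> normc (b u) <= 1) ->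
  schwarz_pick b ->
  (forall u, disk u -> f u = dBR_kernel b u w) -> holomorphic_on_disk f ->
  circle zeta -> disk w -> c < 1 -> normc (b w) <= c ->
  1 - e <= normc w ->
  ((pi^-1 * (k ^+ 2 * e ^+ 2 /
     (1024 * (1 - normc w) * normc (w - zeta) ^+ 2)))%:E <=
   local_dirichlet_integral zeta f)%E.
Proof.
move=> holb b1 SP fk holf /normc_circle nz Dw c1 bwc we.
have c0 : 0 <= c := le_trans (normc_ge0 _) bwc.
have w1 : normc w < 1 by rewrite -diskE.
have e0 : 0 < e by rewrite /e; lra.
have e8 : e <= 1 / 8 by rewrite /e; lra.
have s0 : 0 < 1 - normc w by rewrite subr_gt0.
have sO : 1 - normc w <= normc (w - zeta).
  by rewrite -nz normc_distC ler_normcB.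
set s := 1 - normc w in s0 sO *; set o := normc (w - zeta) in sO *.
have o0 : 0 < o by exact: lt_le_trans sO.
have -> : k ^+ 2 * e ^+ 2 / (1024 * s * o ^+ 2) =
    k ^+ 2 / (256 * s ^+ 3 * o ^+ 2) * (e * s / 2) ^+ 2.
  by field; rewrite !gt_eqF.
apply: (@local_dirichlet_integral_ge _ _ _ (complex.Re w) (complex.Im w)).
- by rewrite divr_ge0 ?sqr_ge0// !mulr_ge0 ?sqr_ge0 ?exprn_ge0 ?ltW.
- by rewrite divr_gt0// mulr_gt0.
move=> u v /andP[u1 u2] /andP[v1 v2].
set z : CC R := u +i* v.
have zw : normc (z - w) <= e * s.
  rewrite /z; case: (w) u1 u2 v1 v2 => p q /= u1 u2 v1 v2.
  rewrite -(ger0_norm (_ : 0 <= e * s)); last by rewrite mulr_ge0 ?ltW.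
  by rewrite -sqrtr_sqr ler_wsqrtr//; nra.
have zle : 1 - normc z <= s + normc (z - w).
  by rewrite /s; have := ler_normcB w z; rewrite normc_distC; lra.
have zw' : normc z <= normc w + normc (z - w).
  by rewrite -[X in normc X <= _](subrK w) addrC; exact: ler_normcD.
have z1 : normc z < 1 by move: zw zw'; rewrite /s in s0 *; nra.
have Dz : disk z by rewrite diskE.
split=> //.
have kF := dBR_kernel_derive_ge holb b1 SP fk (holf _ Dz) Dz Dw c1 bwc we zw.
have XY := normc_oneBmul_conj_le w z1.
have X0 : 0 < normc (1 - w^* * z).
  by apply: lt_le_trans (oneBmul_conj_ge w1 z1); rewrite subr_gt0.
have T0 : 0 < normc (z - zeta).
  apply: (@lt_le_trans _ _ (1 - normc z)); first by rewrite subr_gt0.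
  by rewrite -nz normc_distC ler_normcB.
have T2 : normc (z - zeta) <= normc (z - w) + o.
  by rewrite -[X in normc X <= _](subrKA w); exact: ler_normcD.
have k0 : 0 <= k by rewrite /k divr_ge0// sqr_ge0.
exact: (weighted_square_ge_arith k0 kF X0 XY T0 T2 zle zw z1 (normc_ge0 z) s0
  sO e8).
Qed.

(** * Points approaching the boundary spectrum *)

Lemma boundary_spectrum_approach (R : realType) (b : CC R -> CC R) zeta :
  boundary_spectrum b zeta -> exists2 c : R, c < 1 &
    forall e : R, 0 < e -> exists w, [/\ disk w, normc (w - zeta) < e &
      normc (b w) < c].
Proof.
move=> [_]; rewrite limf_einfE => sup1.
have [c c1 supc] : exists2 c : R, c < 1 &
    (ereal_sup [set ereal_inf ((fun z => (normc (b z))%:E) @` V) |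
      V in within (@disk R) (nbhs zeta)] < c%:E)%E.
  move: sup1; case: ereal_sup => [r r1|//|_].
    rewrite lte_fin in r1; exists ((r + 1) / 2); first by lra.
    by rewrite lte_fin; lra.
  by exists 0; rewrite ?ltNyr.
exists c => // e e0.
have V : within (@disk R) (nbhs zeta) [set w | disk w /\ normc (w - zeta) < e].
  rewrite /within/=; apply/(@nbhs_normP R[i] (CC R) zeta); exists e%:C => /=.
    by rewrite ltcR.
  by move=> w; rewrite /= normr_normc ltcR normc_distC.
have : (ereal_inf ((fun z => (normc (b z))%:E) @`
    [set w : CC R | disk w /\ (normc (w - zeta)%R < e)%R]) < c%:E)%E.
  by apply: le_lt_trans supc; apply: ereal_sup_ubound; eexists; first exact: V.
move=> /ereal_inf_lt[_ [w [Dw we] <-]]; rewrite lte_fin => bc.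
by exists w.
Qed.

Theorem theorem1p2 (R : realType) (b : CC R -> CC R) (zeta : CC R)
    (H : set (CC R -> CC R))
    (ip : (CC R -> CC R) -> (CC R -> CC R) -> CC R)
    (holb : holomorphic_on_disk b)
    (normb : Hinfty_norm b = 1%E)
    (zetab : boundary_spectrum b zeta)
    (Hb : is_dBR b H ip) :
  ~ embeds_local_dirichlet zeta H ip.
Proof.
move=> [sub [M M0 bound]].
have b1 u : disk u -> normc (b u) <= 1.
  by move=> Du; rewrite -lee_fin -normb; apply: ereal_sup_ubound; exists u.
have SP := dBR_schwarz_pick Hb.
have Tz : circle zeta := zetab.1.
have [c c1 appr] := boundary_spectrum_approach zetab.
have c0 : 0 <= c.
  have [w [_ _ /ltW]] := appr _ (@ltr01 R).
  exact: le_trans (normc_ge0 _).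
pose e := (1 - c) / 8; pose k := (1 - c) ^+ 2 / 4.
(* The two bounds on the local Dirichlet integral of [k_w] force
   [k^2 e^2 <= K |w - zeta|^2]. *)
pose K := 1024 * (pi * M).
have p0 := pi_gt0 R.
have K0 : 0 < K by have := mulr_gt0 p0 M0; rewrite /K; lra.
have e0 : 0 < e by rewrite /e; lra.
have e8 : e <= 1 / 8 by rewrite /e; lra.
have k0 : 0 < k by rewrite /k divr_gt0// exprn_gt0// subr_gt0.
have Q0 : 0 < k ^+ 2 * e ^+ 2 by rewrite mulr_gt0 ?exprn_gt0.
have d0 : 0 < Num.min e (k ^+ 2 * e ^+ 2 / K) by rewrite lt_min e0 divr_gt0.
have [w [Dw wz bw]] := appr _ d0.
move: wz; rewrite lt_min => /andP[we wK].
have w1 : normc w < 1 by rewrite -diskE.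
have s0 : 0 < 1 - normc w by rewrite subr_gt0.
have sO : 1 - normc w <= normc (w - zeta).
  by rewrite -(normc_circle Tz) normc_distC ler_normcB.
have Hf := rkhs_kernel Hb Dw.
set f := patch _ _ _ in Hf.
have fk u : disk u -> f u = dBR_kernel b u w.
  by move=> Du; rewrite /f patchE mem_set.
have lower := dBR_kernel_dirichlet_ge holb b1 SP fk (sub _ Hf).1 Tz Dw c1
  (ltW bw) (_ : 1 - (1 - c) / 8 <= normc w).
have {}lower : ((pi^-1 * (k ^+ 2 * e ^+ 2 /
    (1024 * (1 - normc w) * normc (w - zeta) ^+ 2)))%:E <=
    local_dirichlet_integral zeta f)%E by apply: lower; rewrite -/e; lra.
have H2f : (0 <= H2_normsq f)%E.
  apply: le_ereal_sup_tmp; eexists; first by exists 0; rewrite //= lexx ltr01.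
  apply: mule_ge0; last by apply: integral_ge0 => t _; rewrite lee_fin sqr_ge0.
  by rewrite lee_fin invr_ge0 mulr_ge0// ltW.
have := le_trans (le_trans lower (leeDr _ H2f)) (bound _ Hf).
rewrite -(rkhs_reproducing Hb)// fk// dBR_kernel_diag /= lee_fin.
apply/negP; rewrite -ltNge.
set s := 1 - normc w in s0 sO *; set o := normc (w - zeta) in we wK sO *.
have o0 : 0 < o by exact: lt_le_trans sO.
apply: (@le_lt_trans _ _ (M / s)).
  rewrite ler_wpM2l ?(ltW M0)//.
  have sW : s <= 1 - normc w ^+ 2 by have := normc_ge0 w; rewrite /s; nra.
  apply: (@le_trans _ _ (1 / (1 - normc w ^+ 2))).
    rewrite ler_wpM2r ?invr_ge0 ?gerBl ?sqr_ge0//.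
    by apply: le_trans sW; exact: ltW.
  by rewrite mul1r lef_pV2 ?posrE//; exact: lt_le_trans sW.
have Ko : K * o ^+ 2 < k ^+ 2 * e ^+ 2.
  apply: (@le_lt_trans _ _ (K * o)); last by rewrite mulrC -ltr_pdivlMr.
  by rewrite ler_pM2l// expr2 ger_pMl//; lra.
have -> : M / s = pi^-1 * (K * o ^+ 2 / (1024 * s * o ^+ 2)).
  rewrite /K; move: (pi : R) p0 => q q0.
  by field; rewrite !gt_eqF.
have so : 0 < 1024 * s * o ^+ 2.
  by have := mulr_gt0 s0 (exprn_gt0 2 o0); lra.
rewrite ltr_pM2l; last by rewrite invr_gt0.
by rewrite ltr_pM2r; last by rewrite invr_gt0.
Qed.
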